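(* Let $A\in\mathbb{R}^{m\times n}$, $\bar x\in\mathbb{R}^n$, and $b=A\bar x$ (noise-free case, $z=0$). Let $\gamma,\delta',\tilde s,\gamma_{\mathrm{inc}},\gamma_{\mathrm{dec}},L_{\min}$ satisfy the Standing Assumption given in the context (with $z=0$), and let the parameters $\delta,\eta\in(0,1)$ of Algorithm Homotopy (see context) satisfy $\frac{1+\delta}{1+\delta'}\le\eta<1$. Then $\lambda_{\mathrm{tgt}}>0$ can be chosen arbitrarily small in Algorithm Homotopy: for every $\lambda_{\mathrm{tgt}}$ with $0<\lambda_{\mathrm{tgt}}\le\lambda_0=\|A^Tb\|_\infty$, after $K$ outer iterations of the algorithm the iterate $\hat x^{(K)}$ satisfies $$\|\hat x^{(K)}-\bar x\|_2\le\eta^{K+1}\,\frac{2\lambda_0\sqrt{\bar s}}{\rho_-(A,\bar s+\tilde s)}.$$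
   Context: Notation. $f(x)=\frac12\|Ax-b\|_2^2$, so $\nabla f(x)=A^T(Ax-b)$; $\phi_\lambda(x)=f(x)+\lambda\|x\|_1$. The optimality residue is $\omega_\lambda(x)=\min_{\xi\in\partial\|x\|_1}\|\nabla f(x)+\lambda\xi\|_\infty$, where $\partial\|x\|_1$ is the subdifferential of the $\ell_1$ norm at $x$. $\|x\|_0$ is the number of nonzero entries of $x$; $\mathrm{supp}(x)=\{j:x_j\ne0\}$. Restricted eigenvalues. For an integer $s>0$, $\rho_+(A,s)=\sup\{x^TA^TAx/x^Tx: x\ne0,\|x\|_0\le s\}$ and $\rho_-(A,s)=\inf\{x^TA^TAx/x^Tx: x\ne0,\|x\|_0\le s\}$. Standing Assumption (case $z=0$). $\bar S=\mathrm{supp}(\bar x)$, $\bar s=|\bar S|$; $\gamma_{\mathrm{inc}}>1$, $\gamma_{\mathrm{dec}}\ge1$; $\gamma>0$ and $\delta'\in(0,1)$ satisfy $\gamma>(1+\delta')/(1-\delta')$; $\tilde s$ is an integer with $\rho_-(A,\bar s+2\tilde s)>0$ and $$\tilde s>\frac{16\big(\gamma_{\mathrm{inc}}\rho_+(A,\bar s+2\tilde s)+2\rho_+(A,\tilde s)\big)}{\rho_-(A,\bar s+\tilde s)}(1+\gamma)\bar s;$$ and $0<L_{\min}\le\gamma_{\mathrm{inc}}\rho_+(A,\bar s+2\tilde s)$. (The general assumption also requires $\lambda_{\mathrm{tgt}}\ge\max\{4,\frac{\gamma+1}{(1-\delta')\gamma-(1+\delta')}\}\|A^Tz\|_\infty$,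 which is vacuous for $z=0$.) Proximal step. For $L>0$, $\psi_{\lambda,L}(y;x)=f(y)+\nabla f(y)^T(x-y)+\frac L2\|x-y\|_2^2+\lambda\|x\|_1$ and $T_{\lambda,L}(y)=\arg\min_x\psi_{\lambda,L}(y;x)$. Algorithm LineSearch$(\lambda,x,L)$: repeat: set $x^+\leftarrow T_{\lambda,L}(x)$; if $\phi_\lambda(x^+)>\psi_{\lambda,L}(x;x^+)$ then $L\leftarrow L\gamma_{\mathrm{inc}}$; until $\phi_\lambda(x^+)\le\psi_{\lambda,L}(x;x^+)$. Return $\{x^+,M\}$ with $M=L$. Algorithm ProxGrad$(\lambda,\hat\epsilon,x^{(0)},L_0)$, with $\lambda>0$, $\hat\epsilon>0$, $L_0\ge L_{\min}$: for $k=0,1,2,\dots$ compute $\{x^{(k+1)},M_k\}\leftarrow$ LineSearch$(\lambda,x^{(k)},L_k)$ and set $L_{k+1}\leftarrow\max\{L_{\min},M_k/\gamma_{\mathrm{dec}}\}$; stop as soon as $\omega_\lambda(x^{(k+1)})\le\hat\epsilon$ and return $\{\hat x,\hat M\}=\{x^{(k+1)},M_k\}$. Algorithm Homotopy$(A,b,\lambda_{\mathrm{tgt}},\epsilon,L_{\min})$, $\epsilon>0$, with parameters $\eta,\delta\in(0,1)$: initialize $\lambda_0\leftarrow\|A^Tb\|_\infty$, $\hat x^{(0)}\leftarrow0$, $\hat M_0\leftarrow L_{\min}$, $N\leftarrow\lfloor\ln(\lambda_0/\lambda_{\mathrm{tgt}})/\ln(1/\eta)\rfloor$. For $K=0,1,\dots,N-1$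 (the outer iterations): $\lambda_{K+1}\leftarrow\eta\lambda_K$, $\hat\epsilon_{K+1}\leftarrow\delta\lambda_{K+1}$, $\{\hat x^{(K+1)},\hat M_{K+1}\}\leftarrow$ ProxGrad$(\lambda_{K+1},\hat\epsilon_{K+1},\hat x^{(K)},\hat M_K)$. Finally run ProxGrad$(\lambda_{\mathrm{tgt}},\epsilon,\hat x^{(N)},\hat M_N)$ and return its output. The iterate $\hat x^{(K)}$ after $K$ outer iterations is thus defined for $0\le K\le N$. *)

(* Defs.v *)
From HB Require Import structures.
From mathcomp Require Import all_boot all_order all_algebra.
From mathcomp Require Import all_classical all_reals all_analysis.

Set Implicit Arguments.
Unset Strict Implicit.
Unset Printing Implicit Defensive.

Import Order.TTheory GRing.Theory Num.Theory.
Import numFieldNormedType.Exports.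

Local Open Scope classical_set_scope.
Local Open Scope ring_scope.

(* The sup norm of a vector x is the library's matrix
   norm `|x|, which is the maximum of the absolute values of the entries. *)

Definition dot (R : realType) (n : nat) (u v : 'cV[R]_n) : R :=
  (u^T *m v) 0 0.

Definition norm1 (R : realType) (n : nat) (x : 'cV[R]_n) : R :=
  \sum_i `|x i 0|.

Definition norm2 (R : realType) (n : nat) (x : 'cV[R]_n) : R :=
  Num.sqrt (\sum_i x i 0 ^+ 2).

Definition supp (R : realType) (n : nat) (x : 'cV[R]_n) : {set 'I_n} :=
  finset (fun i => x i 0 != 0).

Definition norm0 (R : realType) (n : nat) (x : 'cV[R]_n) : nat := #|supp x|.

Definition rayleigh (R : realType) (m n : nat) (A : 'M[R]_(m, n))
    (x : 'cV[R]_n) : R :=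
  dot x (A^T *m A *m x) / dot x x.

Definition sparse_nz (R : realType) (n s : nat) : set 'cV[R]_n :=
  [set x | x != 0 /\ (norm0 x <= s)%N].

(* For 0 < s and 0 < n, the set of quotients is nonempty and bounded, so these
   are its actual supremum and infimum; sup and inf are 0 on the empty set. *)
Definition rho_plus (R : realType) (m n : nat) (A : 'M[R]_(m, n))
    (s : nat) : R :=
  sup (rayleigh A @` @sparse_nz R n s).

Definition rho_minus (R : realType) (m n : nat) (A : 'M[R]_(m, n))
    (s : nat) : R :=
  inf (rayleigh A @` @sparse_nz R n s).

Definition lsq (R : realType) (m n : nat) (A : 'M[R]_(m, n)) (b : 'cV[R]_m)
    (x : 'cV[R]_n) : R :=
  2^-1 * norm2 (A *m x - b) ^+ 2.

Definition grad_lsq (R : realType) (m n : nat) (A : 'M[R]_(m, n))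
    (b : 'cV[R]_m) (x : 'cV[R]_n) : 'cV[R]_n :=
  A^T *m (A *m x - b).

Definition phi (R : realType) (m n : nat) (A : 'M[R]_(m, n)) (b : 'cV[R]_m)
    (lam : R) (x : 'cV[R]_n) : R :=
  lsq A b x + lam * norm1 x.

Definition subdifferential (R : realType) (n : nat) (g : 'cV[R]_n -> R)
    (x : 'cV[R]_n) : set 'cV[R]_n :=
  [set xi | forall y, g x + dot xi (y - x) <= g y].

(* The infimum is a minimum: the subdifferential of the l1 norm is nonempty and
   compact. *)
Definition omega (R : realType) (m n : nat) (A : 'M[R]_(m, n)) (b : 'cV[R]_m)
    (lam : R) (x : 'cV[R]_n) : R :=
  inf [set `|grad_lsq A b x + lam *: xi| |
       xi in subdifferential (@norm1 R n) x].

Definition argmin (R : realType) (T : Type) (g : T -> R) : set T :=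
  [set x | forall y, g x <= g y].

(* psi lam L y x is the local model at x, built around the base point y. *)
Definition psi (R : realType) (m n : nat) (A : 'M[R]_(m, n)) (b : 'cV[R]_m)
    (lam L : R) (y x : 'cV[R]_n) : R :=
  lsq A b y + dot (grad_lsq A b y) (x - y) + L / 2 * norm2 (x - y) ^+ 2
  + lam * norm1 x.

(* For 0 < L the model is strongly convex and this set is a singleton. *)
Definition prox_step (R : realType) (m n : nat) (A : 'M[R]_(m, n))
    (b : 'cV[R]_m) (lam L : R) (y : 'cV[R]_n) : set 'cV[R]_n :=
  argmin (psi A b lam L y).

(* The unbounded loops are given by big-step semantics:
   line_search ... x L xp M holds when the call with inputs x, L terminates and
   returns (xp, M), and prox_grad ... x L xh Mh holds when the call started at
   the point x with the constant L terminates and returns (xh, Mh). *)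
Inductive line_search (R : realType) (m n : nat) (A : 'M[R]_(m, n))
    (b : 'cV[R]_m) (ginc lam : R) (x : 'cV[R]_n) :
    R -> 'cV[R]_n -> R -> Prop :=
| line_search_stop (L : R) (xp : 'cV[R]_n) :
    prox_step A b lam L x xp ->
    phi A b lam xp <= psi A b lam L x xp ->
    line_search A b ginc lam x L xp L
| line_search_next (L : R) (xp xr : 'cV[R]_n) (M : R) :
    prox_step A b lam L x xp ->
    phi A b lam xp > psi A b lam L x xp ->
    line_search A b ginc lam x (L * ginc) xr M ->
    line_search A b ginc lam x L xr M.

Inductive prox_grad (R : realType) (m n : nat) (A : 'M[R]_(m, n))
    (b : 'cV[R]_m) (ginc gdec Lmin lam eps : R) :
    'cV[R]_n -> R -> 'cV[R]_n -> R -> Prop :=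
| prox_grad_stop (x : 'cV[R]_n) (L : R) (xp : 'cV[R]_n) (M : R) :
    line_search A b ginc lam x L xp M ->
    omega A b lam xp <= eps ->
    prox_grad A b ginc gdec Lmin lam eps x L xp M
| prox_grad_next (x : 'cV[R]_n) (L : R) (xp : 'cV[R]_n) (M : R)
    (xh : 'cV[R]_n) (Mh : R) :
    line_search A b ginc lam x L xp M ->
    omega A b lam xp > eps ->
    prox_grad A b ginc gdec Lmin lam eps xp (Num.max Lmin (M / gdec)) xh Mh ->
    prox_grad A b ginc gdec Lmin lam eps x L xh Mh.

Definition lambda0 (R : realType) (m n : nat) (A : 'M[R]_(m, n))
    (b : 'cV[R]_m) : R :=
  `|A^T *m b|.

Fixpoint lambda_seq (R : realType) (m n : nat) (A : 'M[R]_(m, n))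
    (b : 'cV[R]_m) (eta : R) (K : nat) : R :=
  if K is K'.+1 then eta * lambda_seq A b eta K' else lambda0 A b.

Definition num_outer (R : realType) (m n : nat) (A : 'M[R]_(m, n))
    (b : 'cV[R]_m) (eta lam_tgt : R) : int :=
  Num.floor (ln (lambda0 A b / lam_tgt) / ln (1 / eta)).

(* State (x, M) of the homotopy method after K outer iterations. The target
   regularization only enters through the number of outer iterations, and the
   final call to prox_grad comes after all of them. *)
Inductive homotopy_iter (R : realType) (m n : nat) (A : 'M[R]_(m, n))
    (b : 'cV[R]_m) (ginc gdec Lmin eta delta : R) :
    nat -> 'cV[R]_n -> R -> Prop :=
| homotopy_init : homotopy_iter A b ginc gdec Lmin eta delta 0 0 Lmin
| homotopy_next (K : nat) (x : 'cV[R]_n) (M : R) (x' : 'cV[R]_n) (M' : R) :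
    homotopy_iter A b ginc gdec Lmin eta delta K x M ->
    prox_grad A b ginc gdec Lmin (lambda_seq A b eta K.+1)
      (delta * lambda_seq A b eta K.+1) x M x' M' ->
    homotopy_iter A b ginc gdec Lmin eta delta K.+1 x' M'.

(* Main.v *)
Require Import Defs.
From mathcomp Require Import all_boot all_order all_algebra.
From mathcomp Require Import all_classical all_reals all_analysis.
From mathcomp Require Import ring lra.

Import Order.TTheory GRing.Theory Num.Theory.
Import numFieldNormedType.Exports.

Local Open Scope ring_scope.

(** Write [h = x - xbar], [S = supp xbar], [s = #|S|] and
    [rho = rho_minus A (s + st)].  Since [b = A xbar], the gradient of the
    least-squares term at [x] is [A^T A h].

    The error bound.  If the residue of [x] at level [lam] is at most
    [delta' lam], pairing a minimizing subgradient with [h] gives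
    [|A h|_2^2 + (1 - delta') lam |h_(~S)|_1 <= (1 + delta') lam |h_S|_1]
    ([residue_energy]).  If moreover [x] has at most [st] nonzero entries
    outside [S], then [h] is [(s + st)]-sparse, the left-hand side dominates
    [rho |h|_2^2], the right-hand side is at most
    [2 lam sqrt(s) |h|_2], and [|h|_2 <= 2 lam sqrt(s) / rho]
    ([residue_error]).  The exponent [K + 1], one more than the number of
    stages, comes from a warm start: the output of stage [K] has residue at
    most [delta lambda_K], and replacing [lambda_K] by
    [lambda_(K+1) = eta lambda_K] increases the residue by at most
    [(1 - eta) lambda_K], so that [1 + delta <= eta (1 + delta')] makes it at
    most [delta' lambda_(K+1)] ([warm_start]).  The error bound thus holds
    with [lam = lambda_(K+1)].

    Sparsity outside [S].  The inner loop preserves two facts, bundled as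
    [admissible]: at most [st] nonzero entries outside [S], and an objective
    value not much larger than the one at [xbar].  Together they bound
    [|A h|_2^2] and [|x_(~S)|_1] ([admissible_bounds]).  A proximal step
    thresholds [x - grad / L] at [lam / L], so that an entry outside [S]
    survives only where [L |x_i| >= lam / 2] or [|grad_i| >= lam / 2]; the two
    bounds and the lower bound assumed on [st] leave at most [st] such entries
    when [L <= ginc * rho_plus A (s + 2 st)] ([prox_off_supp]).

    Termination.  The difference of two points with at most [st] nonzero
    entries outside [S] is [(s + 2 st)]-sparse, so the line search accepts as
    soon as [L >= rho_plus A (s + 2 st)]; its constants therefore never leave
    the range in which sparsity is preserved.  Each accepted step lowers the
    objective by at least [L/2 |x - xp|_2^2], whereas the new residue is at most a
    constant times [|x - xp|_2] ([prox_residue_le]).  While the residue exceeds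
    the tolerance, the objective decreases by a fixed amount at each step,
    and it is nonnegative. *)

(** * Euclidean, l1 and sup norms of vectors *)

Section EuclideanVectors.
Set Implicit Arguments.
Unset Strict Implicit.
Variable R : realType.

Lemma dotE n (u v : 'cV[R]_n) : dot u v = \sum_i u i 0 * v i 0.
Proof. by rewrite /dot mxE; apply: eq_bigr => i _; rewrite mxE. Qed.

Lemma dotC n (u v : 'cV[R]_n) : dot u v = dot v u.
Proof. by rewrite !dotE; apply: eq_bigr => i _; rewrite mulrC. Qed.

Lemma dotDr n (u v w : 'cV[R]_n) : dot u (v + w) = dot u v + dot u w.
Proof.
by rewrite !dotE -big_split; apply: eq_bigr => i _; rewrite mxE mulrDr.
Qed.

Lemma dotZr n a (u v : 'cV[R]_n) : dot u (a *: v) = a * dot u v.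
Proof.
by rewrite !dotE mulr_sumr; apply: eq_bigr => i _; rewrite mxE mulrCA.
Qed.

Lemma dot0r n (u : 'cV[R]_n) : dot u 0 = 0.
Proof. by rewrite -[X in dot u X](scale0r u) dotZr mul0r. Qed.

Lemma dotBr n (u v w : 'cV[R]_n) : dot u (v - w) = dot u v - dot u w.
Proof. by rewrite dotDr -scaleN1r dotZr mulN1r. Qed.

Lemma dotDl n (u v w : 'cV[R]_n) : dot (v + w) u = dot v u + dot w u.
Proof. by rewrite dotC dotDr !(dotC u). Qed.

Lemma dotZl n a (u v : 'cV[R]_n) : dot (a *: v) u = a * dot v u.
Proof. by rewrite dotC dotZr (dotC u). Qed.

Lemma dotBl n (u v w : 'cV[R]_n) : dot (v - w) u = dot v u - dot w u.
Proof. by rewrite dotC dotBr !(dotC u). Qed.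

Lemma dot_mulmxl m n (A : 'M[R]_(m, n)) u v :
  dot u (A^T *m v) = dot (A *m u) v.
Proof. by rewrite /dot trmx_mul mulmxA. Qed.

Lemma norm2_sqr n (u : 'cV[R]_n) : norm2 u ^+ 2 = dot u u.
Proof.
rewrite /norm2 sqr_sqrtr; last by apply: sumr_ge0 => i _; exact: sqr_ge0.
by rewrite dotE; apply: eq_bigr => i _; rewrite expr2.
Qed.

Lemma norm2_ge0 n (u : 'cV[R]_n) : 0 <= norm2 u.
Proof. exact: sqrtr_ge0. Qed.

Lemma norm2_eq0 n (u : 'cV[R]_n) : norm2 u = 0 -> u = 0.
Proof.
move=> u0; have := norm2_sqr u; rewrite u0 dotE expr0n /= => /esym/eqP.
rewrite psumr_eq0 => [/allP u0'|i _]; last by rewrite -expr2 sqr_ge0.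
apply/matrixP => i j; rewrite mxE (ord1 j).
by have := u0' i (mem_index_enum i); rewrite mulf_eq0 orbb => /eqP.
Qed.

Lemma cauchy_schwarz n (u v : 'cV[R]_n) :
  dot u v ^+ 2 <= norm2 u ^+ 2 * norm2 v ^+ 2.
Proof.
have [v0|v_neq0] := eqVneq (norm2 v) 0.
  rewrite (norm2_eq0 v0) dot0r expr0n /=.
  by rewrite mulr_ge0 ?sqr_ge0.
have v_gt0 : 0 < norm2 v ^+ 2 by rewrite exprn_gt0 // lt0r v_neq0 norm2_ge0.
set a := norm2 v ^+ 2 in v_gt0 *; set b := dot u v; set d := norm2 u ^+ 2.
have := sqr_ge0 (norm2 (a *: u - b *: v)).
rewrite norm2_sqr !(dotBl, dotBr, dotZl, dotZr) (dotC v u) -!norm2_sqr.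
rewrite -/a -/b -/d.
rewrite [leRHS](_ : _ = a * (d * a - b ^+ 2)); last by ring.
by rewrite pmulr_rge0 // subr_ge0.
Qed.

(** Cauchy-Schwarz against the indicator vector of [S]. *)
Lemma sqr_sum_abs_le n (S : {set 'I_n}) (h : 'cV[R]_n) :
  (\sum_(i in S) `|h i 0|) ^+ 2 <= #|S|%:R * norm2 h ^+ 2.
Proof.
pose u : 'cV[R]_n := \col_i (i \in S)%:R; pose v : 'cV[R]_n := \col_i `|h i 0|.
have -> : \sum_(i in S) `|h i 0| = dot u v.
  rewrite dotE big_mkcond; apply: eq_bigr => i _; rewrite !mxE.
  by case: (i \in S); rewrite ?mul1r ?mul0r.
have -> : #|S|%:R = norm2 u ^+ 2.
  rewrite norm2_sqr dotE -sum1_card natr_sum big_mkcond; apply: eq_bigr => i _.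
  by rewrite !mxE; case: (i \in S); rewrite ?mul1r ?mul0r.
have -> : norm2 h ^+ 2 = norm2 v ^+ 2.
  rewrite !norm2_sqr !dotE; apply: eq_bigr => i _.
  by rewrite !mxE -normrM -expr2 ger0_norm ?sqr_ge0.
exact: cauchy_schwarz.
Qed.

Lemma norm1_ge0 n (x : 'cV[R]_n) : 0 <= norm1 x.
Proof. exact: sumr_ge0. Qed.

Lemma norm1_split n (S : {set 'I_n}) (x : 'cV[R]_n) :
  norm1 x = \sum_(i in S) `|x i 0| + \sum_(i in ~: S) `|x i 0|.
Proof.
rewrite /norm1 (bigID (mem S)) /=; congr (_ + _).
by apply: eq_bigl => i; rewrite inE.
Qed.

Lemma ler_norm1D n (x y : 'cV[R]_n) : norm1 (x + y) <= norm1 x + norm1 y.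
Proof. by rewrite /norm1 -big_split ler_sum // => i _; rewrite mxE ler_normD. Qed.

Lemma norm1Z n a (x : 'cV[R]_n) : norm1 (a *: x) = `|a| * norm1 x.
Proof.
by rewrite /norm1 mulr_sumr; apply: eq_bigr => i _; rewrite mxE normrM.
Qed.

Lemma abs_entry_le n (x : 'cV[R]_n) i : `|x i 0| <= `|x|.
Proof.
rewrite {2}/Num.norm /= mx_normrE.
exact: (le_bigmax _ (fun ij : 'I_n * 'I_1 => `|x ij.1 ij.2|) (i, 0)).
Qed.

Lemma sup_norm_le n (x : 'cV[R]_n) a :
  0 <= a -> (forall i, `|x i 0| <= a) -> `|x| <= a.
Proof.
move=> a0 xa; rewrite {1}/Num.norm /= mx_normrE; apply/bigmax_leP; split => //.
by move=> [i j] _ /=; rewrite (ord1 j).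
Qed.

Lemma dot_le_sup_norm1 n (u v : 'cV[R]_n) : dot u v <= `|u| * norm1 v.
Proof.
rewrite dotE /norm1 mulr_sumr ler_sum // => i _.
by rewrite (le_trans (ler_norm _)) // normrM ler_wpM2r // abs_entry_le.
Qed.

Lemma abs_entry_le_norm2 n (x : 'cV[R]_n) i : `|x i 0| <= norm2 x.
Proof.
rewrite -(ler_pXn2r (n := 2)) ?nnegrE ?norm2_ge0 // norm2_sqr dotE.
rewrite real_normK ?num_real //.
by rewrite (bigD1 i) //= -expr2 lerDl sumr_ge0 // => j _; rewrite -expr2 sqr_ge0.
Qed.

Lemma sup_norm_mulmx_le n (G : 'M[R]_n) (h : 'cV[R]_n) :
  `|G *m h| <= (\sum_i \sum_j `|G i j|) * norm2 h.
Proof.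
apply: sup_norm_le => [|i].
  by rewrite mulr_ge0 ?norm2_ge0 // sumr_ge0 // => i _; rewrite sumr_ge0.
rewrite mxE [X in _ <= X * _](bigD1 i) //= mulrDl -[leLHS]addr0 lerD //; last first.
  by rewrite mulr_ge0 ?norm2_ge0 // sumr_ge0 // => k _; rewrite sumr_ge0.
rewrite (le_trans (ler_norm_sum _ _ _)) // mulr_suml ler_sum // => j _.
by rewrite normrM ler_wpM2l // abs_entry_le_norm2.
Qed.

End EuclideanVectors.

(** * Restricted eigenvalues *)

Section RestrictedEigenvalues.
Set Implicit Arguments.
Unset Strict Implicit.
Variables (R : realType) (m n : nat) (A : 'M[R]_(m, n)).

Lemma rayleighE x : rayleigh A x = norm2 (A *m x) ^+ 2 / norm2 x ^+ 2.
Proof. by rewrite /rayleigh -mulmxA dot_mulmxl !norm2_sqr. Qed.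

Lemma rayleigh_ge0 x : 0 <= rayleigh A x.
Proof. by rewrite rayleighE divr_ge0 ?sqr_ge0. Qed.

Lemma norm2_sqr_gt0 (x : 'cV[R]_n) : x != 0 -> 0 < norm2 x ^+ 2.
Proof.
move=> x0; rewrite exprn_gt0 // lt0r norm2_ge0 andbT.
by apply: contra x0 => /eqP/norm2_eq0 ->.
Qed.

(** A crude bound by the Frobenius norm; its role is to make the Rayleigh
    quotients bounded, so that [rho_plus] is a true supremum. *)
Lemma norm2_mulmx_le x :
  norm2 (A *m x) ^+ 2 <= (\sum_i norm2 (row i A)^T ^+ 2) * norm2 x ^+ 2.
Proof.
rewrite norm2_sqr dotE mulr_suml ler_sum // => i _.
rewrite -expr2 (le_trans _ (cauchy_schwarz _ _)) // dotE !mxE.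
by under [X in _ <= X ^+ 2]eq_bigr do rewrite !mxE.
Qed.

Lemma has_ubound_rayleigh s :
  has_ubound (rayleigh A @` @sparse_nz R n s)%classic.
Proof.
exists (\sum_i norm2 (row i A)^T ^+ 2) => _ [x [x0 _] <-].
by rewrite rayleighE ler_pdivrMr ?norm2_sqr_gt0 // norm2_mulmx_le.
Qed.

Lemma has_lbound_rayleigh s :
  has_lbound (rayleigh A @` @sparse_nz R n s)%classic.
Proof. by exists 0 => _ [x _ <-]; exact: rayleigh_ge0. Qed.

Lemma rho_plus_ge0 s : 0 <= rho_plus A s.
Proof.
have [[q Eq]|/set0P/negP/negPn/eqP E0] :=
  pselect (rayleigh A @` @sparse_nz R n s !=set0)%classic.
  apply: (@le_trans _ _ q); last exact: ub_le_sup (has_ubound_rayleigh s) _ Eq.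
  by case: Eq => x _ <-; exact: rayleigh_ge0.
by rewrite /rho_plus E0 sup0.
Qed.

Lemma rho_plus_ub s x : (norm0 x <= s)%N ->
  norm2 (A *m x) ^+ 2 <= rho_plus A s * norm2 x ^+ 2.
Proof.
move=> xs; have [->|x0] := eqVneq x 0.
  by rewrite mulmx0 !norm2_sqr !dot0r mulr0.
rewrite -ler_pdivrMr ?norm2_sqr_gt0 // -rayleighE.
by apply: ub_le_sup; [exact: has_ubound_rayleigh | exists x].
Qed.

Lemma rho_minus_lb s x : (norm0 x <= s)%N ->
  rho_minus A s * norm2 x ^+ 2 <= norm2 (A *m x) ^+ 2.
Proof.
move=> xs; have [->|x0] := eqVneq x 0.
  by rewrite mulmx0 !norm2_sqr !dot0r mulr0.
rewrite -ler_pdivlMr ?norm2_sqr_gt0 // -rayleighE.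
by apply: ge_inf; [exact: has_lbound_rayleigh | exists x].
Qed.

(** The infimum over fewer vectors is at least as large, but only because the
    smaller set is nonempty: the infimum of the empty set is 0.  A positive infimum at
    [s'] yields a nonzero vector, hence a coordinate vector of sparsity 1. *)
Lemma rho_minus_gt0W s s' : (0 < s <= s')%N ->
  0 < rho_minus A s' -> 0 < rho_minus A s.
Proof.
move=> /andP[s0 ss'] r0; apply: (lt_le_trans r0).
have [[_ [x [x0 _] _]]|/set0P/negP/negPn/eqP E0] :=
  pselect (rayleigh A @` @sparse_nz R n s' !=set0)%classic; last first.
  by move: r0; rewrite /rho_minus E0 inf0 ltxx.
have [i xi0] : exists i, x i 0 != 0.
  apply/existsP; apply: contraNT x0; rewrite negb_exists => /forallP x0.
  by apply/eqP/matrixP => i j; rewrite (ord1 j) mxE; apply/eqP/negPn/x0.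
apply: lb_le_inf => [|_ [y [y0 ys] <-]].
  exists (rayleigh A (delta_mx i 0)), (delta_mx i 0) => //; split.
    by apply/eqP => /matrixP/(_ i 0)/eqP; rewrite !mxE !eqxx /= oner_eq0.
  apply: (@leq_trans #|[set i]%SET|); last by rewrite cards1.
  apply: subset_leq_card.
  by apply/fintype.subsetP => j; rewrite !inE mxE; case: (j == i); rewrite //= eqxx.
apply: ge_inf; first exact: has_lbound_rayleigh.
by exists y => //; split=> //; exact: leq_trans ss'.
Qed.

End RestrictedEigenvalues.

(** * Subgradients of the l1 norm and the optimality residue *)

Section Subgradients.
Set Implicit Arguments.
Unset Strict Implicit.
Variables (R : realType) (n : nat).
Implicit Types x y xi : 'cV[R]_n.

Lemma norm1_add_delta x i t :
  norm1 (x + t *: delta_mx i 0) = norm1 x - `|x i 0| + `|x i 0 + t|.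
Proof.
rewrite /norm1 (bigD1 i) //= [in RHS](bigD1 i) //= !mxE !eqxx mulr1.
rewrite [X in _ + X = _](eq_bigr (fun j => `|x j 0|)) => [|j ji]; first by ring.
by rewrite !mxE (negbTE ji) mulr0 addr0.
Qed.

(** The l1 norm is separable, so testing a subgradient on perturbations of a
    single coordinate is enough. *)
Lemma subdifferential_norm1P x xi :
  subdifferential (@norm1 R n) x xi <->
  forall i, `|xi i 0| <= 1 /\ xi i 0 * x i 0 = `|x i 0|.
Proof.
split=> [sub i|xiP y]; last first.
  rewrite dotE /norm1 -big_split ler_sum //= => i _.
  have [xi1 <-] := xiP i; rewrite !mxE mulrBr addrC subrK.
  rewrite (le_trans (ler_norm _)) // normrM -[leRHS]mul1r.
  by rewrite ler_wpM2r.
have step t : xi i 0 * t <= `|x i 0 + t| - `|x i 0|.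
  have := sub (x + t *: delta_mx i 0).
  rewrite norm1_add_delta addrAC subrr add0r dotZr dotE (bigD1 i) //= mxE !eqxx.
  rewrite big1 => [|j ji]; last by rewrite mxE (negbTE ji) mulr0.
  by rewrite mulr1 addr0; lra.
have up t : xi i 0 * t <= `|t| by have := step t; have := ler_normD (x i 0) t; lra.
split.
  (* The two signed unit perturbations bound the entry; the one that cancels
     [x i 0] and the one that doubles it give the equality. *)
  by rewrite ler_norml; have := up 1; have := up (- 1); rewrite normrN normr1; lra.
have := step (- x i 0); rewrite subrr normr0.
by have := up (x i 0); lra.
Qed.

Lemma subdifferential_norm1_sup x xi :
  subdifferential (@norm1 R n) x xi -> `|xi| <= 1.
Proof.
by move=> /subdifferential_norm1P xiP; apply: sup_norm_le => // i; case: (xiP i).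
Qed.

End Subgradients.

Section OptimalityResidue.
Set Implicit Arguments.
Unset Strict Implicit.
Variables (R : realType) (m n : nat) (A : 'M[R]_(m, n)) (b : 'cV[R]_m).
Implicit Types (x xi : 'cV[R]_n) (lam eta : R).

Lemma omega_le lam x xi : subdifferential (@norm1 R n) x xi ->
  omega A b lam x <= `|grad_lsq A b x + lam *: xi|.
Proof. by move=> xix; apply: ge_inf; [exists 0 => _ [? _ <-] | exists xi]. Qed.

(** Minimizing [`|g + lam * z|] over the subgradients [z] of the absolute
    value at [u]: the choice is forced unless [u = 0], and then [- g / lam]
    is projected onto [-1, 1].  All coordinates can be minimized
    independently, which is why the infimum defining [omega] is attained. *)
Lemma best_subgradient_coord lam (g u : R) : 0 < lam ->
  exists z, [/\ `|z| <= 1, z * u = `|u| &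
    forall z', `|z'| <= 1 -> z' * u = `|u| -> `|g + lam * z| <= `|g + lam * z'|].
Proof.
move=> lam0; have [u0|u0] := eqVneq u 0; last first.
  exists (Num.sg u); split; rewrite ?mulr_sg_norm //.
  - by rewrite normr_sg u0.
  - by rewrite [RHS]normrEsg.
  move=> z' _ zu; suff -> : z' = Num.sg u by [].
  by apply: (mulIf u0); rewrite zu normrEsg.
have [gl|gl] := ltP lam g.
  exists (- 1); split=> [||z' z'1 _]; rewrite ?normrN ?normr1 ?u0 ?mulr0 ?normr0 //.
  by move: z'1; rewrite ler_norml => /andP[? ?]; rewrite !ger0_norm; nra.
have [gl'|gl'] := ltP g (- lam).
  exists 1; split=> [||z' z'1 _]; rewrite ?normr1 ?u0 ?mulr0 ?normr0 //.
  by move: z'1; rewrite ler_norml => /andP[? ?]; rewrite !ler0_norm; nra.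
exists (- (g / lam)); split=> [||z' _ _]; rewrite ?u0 ?mulr0 ?normr0 //.
  by rewrite normrN ler_norml ler_pdivrMr // ler_pdivlMr //; lra.
by rewrite mulrN mulrC divfK ?lt0r_neq0 // subrr normr0.
Qed.

Lemma omega_attained lam x : 0 < lam ->
  exists2 xi, subdifferential (@norm1 R n) x xi &
    `|grad_lsq A b x + lam *: xi| = omega A b lam x.
Proof.
move=> lam0; pose g := grad_lsq A b x.
have /choice[z zP] i := best_subgradient_coord (g i 0) (x i 0) lam0.
have sub : subdifferential (@norm1 R n) x (\col_i z i).
  by apply/subdifferential_norm1P => i; rewrite mxE; case: (zP i).
exists (\col_i z i) => //; apply/le_anti; rewrite omega_le // andbT.
apply: lb_le_inf => [|_ [xi /subdifferential_norm1P xiP <-]].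
  by eexists; exists (\col_i z i).
apply: sup_norm_le => // i; have [z1 zx zmin] := zP i; have [xi1 xix] := xiP i.
have e y : (g + lam *: y) i 0 = g i 0 + lam * y i 0 by rewrite mxE [X in _ + X]mxE.
rewrite -/g e [X in lam * X]mxE (le_trans (zmin _ xi1 xix)) // -e.
exact: abs_entry_le.
Qed.

(** Subgradients of the l1 norm are bounded by 1 in sup norm, so changing the
    weight by [(1 - eta) lam] moves the residue by at most that much. *)
Lemma omega_scale_le lam eta x : 0 < lam -> 0 < eta <= 1 ->
  omega A b (eta * lam) x <= omega A b lam x + (1 - eta) * lam.
Proof.
move=> lam0 /andP[eta0 eta1]; have [xi xix <-] := omega_attained x lam0.
rewrite (le_trans (omega_le _ xix)) //.
have -> : grad_lsq A b x + (eta * lam) *: xi =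
  (grad_lsq A b x + lam *: xi) - ((1 - eta) * lam) *: xi.
  by rewrite -addrA -scalerBl; congr (_ + _ *: _); ring.
rewrite (le_trans (ler_normB _ _)) // lerD2l.
have c0 : 0 <= (1 - eta) * lam by rewrite mulr_ge0 ?subr_ge0 // ltW.
by rewrite mx_normZ ger0_norm // ler_piMr // (subdifferential_norm1_sup xix).
Qed.

End OptimalityResidue.

(** * Proximal steps *)

Section ProximalStep.
Set Implicit Arguments.
Unset Strict Implicit.
Variables (R : realType) (m n : nat) (A : 'M[R]_(m, n)) (b : 'cV[R]_m).
Variables (lam L : R) (lam_gt0 : 0 < lam) (L_gt0 : 0 < L).
Implicit Types x y z : 'cV[R]_n.

(** The least-squares term is quadratic, so its second-order expansion is
    exact. *)
Lemma lsq_taylor x y :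
  lsq A b y = lsq A b x + dot (grad_lsq A b x) (y - x)
              + 2^-1 * norm2 (A *m (y - x)) ^+ 2.
Proof.
rewrite /lsq /grad_lsq (dotC _ (y - x)) dot_mulmxl.
have -> : A *m y - b = (A *m x - b) + A *m (y - x).
  by rewrite mulmxBr [RHS]addrC addrA subrK.
rewrite !norm2_sqr; move: (A *m x - b) (A *m (y - x)) => u v.
by rewrite !(dotDl, dotDr) (dotC v u); field.
Qed.

Lemma grad_lsqB x y :
  grad_lsq A b y - grad_lsq A b x = A^T *m A *m (y - x).
Proof.
by rewrite /grad_lsq -mulmxBr opprB addrA subrK -mulmxBr mulmxA.
Qed.

Lemma psi_base x : psi A b lam L x x = phi A b lam x.
Proof.
by rewrite /psi /phi subrr norm2_sqr !dot0r; ring.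
Qed.

Definition model_grad x z := grad_lsq A b x + L *: (z - x).

Lemma psi_expand x z y :
  psi A b lam L x y = psi A b lam L x z + dot (model_grad x z) (y - z)
    + L / 2 * norm2 (y - z) ^+ 2 + lam * (norm1 y - norm1 z).
Proof.
rewrite /psi /model_grad.
have -> : y - x = (z - x) + (y - z) by rewrite [RHS]addrC addrA subrK.
rewrite !norm2_sqr; move: (z - x) (y - z) (grad_lsq A b x) => u v g.
by rewrite !(dotDl, dotDr, dotZl) (dotC v u); field.
Qed.

(** The vector that must be a subgradient of the l1 norm at [z] for [z] to
    minimize the model: the stationarity condition is
    [model_grad x z + lam *: xi = 0]. *)
Definition prox_subgrad x z := - lam^-1 *: model_grad x z.

Lemma prox_subgradE x z :
  lam *: prox_subgrad x z = - model_grad x z.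
Proof. by rewrite scalerA mulrN divff ?lt0r_neq0 // scaleN1r. Qed.

Lemma dot_model_grad x z y :
  dot (model_grad x z) y = - lam * dot (prox_subgrad x z) y.
Proof. by rewrite dotZl mulrA mulrNN divff ?mul1r ?lt0r_neq0. Qed.

Lemma psi_strong_convex x z : subdifferential (@norm1 R n) z (prox_subgrad x z) ->
  forall y, psi A b lam L x z + L / 2 * norm2 (y - z) ^+ 2 <= psi A b lam L x y.
Proof.
move=> zP y; rewrite (psi_expand x z y) dot_model_grad.
by have := ler_wpM2l (ltW lam_gt0) (zP y); rewrite mulrDr; lra.
Qed.

(** First-order optimality.  For necessity, the model is compared at [z] and
    at [z + t (y - z)]: the smooth part is linear in [t] up to [O(t^2)], the l1
    part is convex, and [t] tends to 0. *)
Lemma prox_stepP x z :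
  prox_step A b lam L x z <-> subdifferential (@norm1 R n) z (prox_subgrad x z).
Proof.
split=> [zmin y|zP y]; last first.
  rewrite (le_trans _ (psi_strong_convex zP y)) // lerDl.
  by rewrite mulr_ge0 ?sqr_ge0 // divr_ge0 // ltW.
set q := dot (prox_subgrad x z) (y - z); set N := norm2 (y - z) ^+ 2.
have N0 : 0 <= N by exact: sqr_ge0.
pose E := lam * (norm1 y - norm1 z - q).
suff : 0 <= E by rewrite /E pmulr_rge0 // ; lra.
have key t : 0 < t -> t <= 1 -> 0 <= E + t * (L / 2 * N).
  move=> t0 t1; rewrite -(pmulr_rge0 _ t0).
  have := zmin (z + t *: (y - z)).
  rewrite (psi_expand x z (z + _)) (addrAC z) subrr add0r dotZr dot_model_grad -/q.
  rewrite !norm2_sqr dotZl dotZr -norm2_sqr -/N.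
  have : norm1 (z + t *: (y - z)) <= (1 - t) * norm1 z + t * norm1 y.
    have -> : z + t *: (y - z) = (1 - t) *: z + t *: y.
      by rewrite scalerBr scalerBl scale1r addrAC addrA.
    by rewrite (le_trans (ler_norm1D _ _)) // !norm1Z !ger0_norm ?subr_ge0 // ltW.
  move=> /(ler_wpM2l (ltW lam_gt0)); rewrite /E; nra.
rewrite leNgt; apply/negP => E0.
have P : 0 <= L / 2 * N by rewrite mulr_ge0 // divr_ge0 // ltW.
(* A step for which the quadratic term is at most half of [- E]. *)
pose t := Num.min 1 (- E / (L * N + 1)).
have d0 : 0 < L * N + 1 by rewrite ltr_wpDl // mulr_ge0 // ltW.
have t0 : 0 < t by rewrite /t lt_min ltr01 divr_gt0 // oppr_gt0.
have t1 : t <= 1 by rewrite /t ge_min lexx.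
have : t * (L * N + 1) <= - E by rewrite -ler_pdivlMr // /t ge_min lexx orbT.
by have := key t t0 t1; nra.
Qed.

(** Scalar stationarity: [p] is the soft thresholding of [v] at level [tau],
    and [(v - p) / tau] a subgradient of the absolute value at [p]. *)
Lemma soft_threshold tau (v : R) : 0 < tau ->
  exists p, `|(v - p) / tau| <= 1 /\ (v - p) / tau * p = `|p|.
Proof.
move=> tau0; have tau1 : tau / tau = 1 by rewrite divff // lt0r_neq0.
have [vt|vt] := ltP tau v.
  exists (v - tau); rewrite subKr tau1 normr1 mul1r; split=> //.
  by rewrite gtr0_norm ?subr_gt0.
have [vt'|vt'] := ltP v (- tau).
  exists (v + tau); rewrite opprD addrA subrr add0r mulNr tau1 normrN normr1.
  rewrite mulN1r; split=> //.
  by rewrite ltr0_norm //; lra.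
exists 0; rewrite subr0 mulr0 normr0; split=> //.
by rewrite ler_norml ler_pdivrMr // ler_pdivlMr //; lra.
Qed.

Lemma prox_step_exists x : exists z, prox_step A b lam L x z.
Proof.
have tau0 : 0 < lam / L by exact: divr_gt0.
have /choice[p pP] (i : 'I_n) :=
  soft_threshold (x i 0 - grad_lsq A b x i 0 / L) tau0.
exists (\col_i p i); apply/prox_stepP/subdifferential_norm1P => i.
suff -> : prox_subgrad x (\col_i p i) i 0
       = (x i 0 - grad_lsq A b x i 0 / L - p i) / (lam / L).
  by rewrite [(\col_j p j) i 0]mxE; exact: pP.
rewrite /prox_subgrad /model_grad; move: (grad_lsq A b x) => g; rewrite !mxE.
by field; rewrite !lt0r_neq0.
Qed.

End ProximalStep.

(** * Error bounds and sparsity outside the support of the signal *)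

Section SparsityOffSupport.
Set Implicit Arguments.
Unset Strict Implicit.
Variables (R : realType) (m n : nat) (A : 'M[R]_(m, n)) (xbar : 'cV[R]_n).
Variables (gamma Lmax : R) (st : nat).
Local Notation b := (A *m xbar).
Local Notation S := (supp xbar).
Local Notation s := (norm0 xbar).
Local Notation rho := (rho_minus A (norm0 xbar + st)).
Implicit Types (x y h : 'cV[R]_n) (lam L : R).

Definition off_supp x : {set 'I_n} := supp x :\: supp xbar.

Definition on_norm1 h : R := \sum_(i in S) `|h i 0|.
Definition off_norm1 h : R := \sum_(i in ~: S) `|h i 0|.

Lemma norm0_sub_xbar x : (norm0 (x - xbar)%R <= s + #|off_supp x|)%N.
Proof.
rewrite (leq_trans _ (leq_card_setU _ _)) // subset_leq_card //.
apply/fintype.subsetP => i; rewrite !inE !mxE.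
apply: contraNT; rewrite negb_or negb_and !negbK => /andP[/eqP ->].
by rewrite eqxx /= => /eqP ->; rewrite subrr.
Qed.

Lemma norm0_sub x y : (norm0 (x - y)%R <= s + (#|off_supp x| + #|off_supp y|))%N.
Proof.
apply: (@leq_trans #|S :|: (off_supp x :|: off_supp y)|); last first.
  rewrite (leq_trans (leq_card_setU _ _)) // leq_add2l; exact: leq_card_setU.
apply/subset_leq_card/fintype.subsetP => i; rewrite !inE !mxE.
apply: contraNT; rewrite !negb_or !negb_and !negbK => /and3P[/eqP ->].
by rewrite eqxx /= => /eqP -> /eqP ->; rewrite subrr.
Qed.

Lemma lsq_sub x : lsq A b x = 2^-1 * norm2 (A *m (x - xbar)) ^+ 2.
Proof. by rewrite /lsq mulmxBr. Qed.

Lemma dot_grad_lsq x u : dot (grad_lsq A b x) u = dot (A *m (x - xbar)) (A *m u).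
Proof. by rewrite dotC dot_mulmxl dotC mulmxBr. Qed.

Lemma norm1_on_off h : norm1 h = on_norm1 h + off_norm1 h.
Proof. exact: norm1_split. Qed.

Lemma on_norm1_ge0 h : 0 <= on_norm1 h. Proof. exact: sumr_ge0. Qed.
Lemma off_norm1_ge0 h : 0 <= off_norm1 h. Proof. exact: sumr_ge0. Qed.

Lemma off_norm1_sub x : off_norm1 (x - xbar) = off_norm1 x.
Proof.
apply: eq_bigr => i; rewrite !inE !mxE negbK => /eqP ->.
by rewrite subr0.
Qed.

Lemma norm1_xbar_sub x :
  norm1 xbar - norm1 x <= on_norm1 (x - xbar) - off_norm1 (x - xbar).
Proof.
rewrite off_norm1_sub !norm1_on_off.
have -> : off_norm1 xbar = 0.
  by apply: big1 => i; rewrite !inE negbK => /eqP ->; rewrite normr0.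
suff : on_norm1 xbar <= on_norm1 x + on_norm1 (x - xbar) by lra.
rewrite /on_norm1 -big_split ler_sum //= => i _; rewrite !mxE.
by rewrite -[X in `|X| <= _](subKr (x i 0)) ler_normB.
Qed.

(** On [S] a subgradient is only known to be bounded by 1, but outside [S],
    where [xbar] vanishes, it pairs with [x] to give its full l1 norm. *)
Lemma subgradient_cone x xi : subdifferential (@norm1 R n) x xi ->
  off_norm1 (x - xbar) - on_norm1 (x - xbar) <= dot xi (x - xbar).
Proof.
move=> /(_ xbar); rewrite -[xbar - x]opprB -scaleN1r dotZr => xiP.
by have := norm1_xbar_sub x; lra.
Qed.

(** The pairing of [grad + lam xi] with [h] is [|A h|^2 + lam <xi, h>]; it is at
    most [d lam |h|_1] by Hoelder, and [<xi, h>] is bounded below by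
    [subgradient_cone]. *)
Lemma residue_energy lam d x : 0 < lam -> omega A b lam x <= d * lam ->
  norm2 (A *m (x - xbar)) ^+ 2 + (1 - d) * lam * off_norm1 (x - xbar)
    <= (1 + d) * lam * on_norm1 (x - xbar).
Proof.
move=> lam0; have [xi xix <-] := omega_attained A b x lam0 => omd.
have /(ler_wpM2l (ltW lam0)) cone := subgradient_cone xix.
have := le_trans (dot_le_sup_norm1 _ _) (ler_wpM2r (norm1_ge0 (x - xbar)) omd).
rewrite dotDl dotZl dot_grad_lsq -norm2_sqr norm1_on_off.
by lra.
Qed.

(** Convexity of the objective along the segment from [x] to [xbar]. *)
Lemma residue_gap lam d x : 0 < lam -> omega A b lam x <= d * lam ->
  phi A b lam x <= phi A b lam xbar + d * lam * norm1 (x - xbar).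
Proof.
move=> lam0; have [xi xix <-] := omega_attained A b x lam0 => omd.
have := le_trans (dot_le_sup_norm1 _ _) (ler_wpM2r (norm1_ge0 (x - xbar)) omd).
have := ler_wpM2l (ltW lam0) (xix xbar).
rewrite /phi (lsq_taylor _ _ x xbar) -[xbar - x]opprB -scaleN1r !dotZr dotDl dotZl.
have := sqr_ge0 (norm2 (A *m (-1 *: (x - xbar)))).
by lra.
Qed.

(** Restricted strong convexity, in the form that the l1 estimates use: it
    applies to [h] because [h] is [(s + st)]-sparse. *)
Lemma on_norm1_sqr_le x : (#|off_supp x| <= st)%N -> 0 < rho ->
  rho * on_norm1 (x - xbar) ^+ 2 <= s%:R * norm2 (A *m (x - xbar)) ^+ 2.
Proof.
move=> xst rho0.
have xs : (norm0 (x - xbar)%R <= s + st)%N.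
  by rewrite (leq_trans (norm0_sub_xbar x)) // leq_add2l.
rewrite (le_trans (ler_wpM2l (ltW rho0) (sqr_sum_abs_le S (x - xbar)))) //.
by rewrite mulrCA ler_wpM2l // rho_minus_lb.
Qed.

Lemma residue_on_norm1 lam d x : 0 < lam -> 0 < rho -> 0 <= d <= 1 ->
  (#|off_supp x| <= st)%N -> omega A b lam x <= d * lam ->
  on_norm1 (x - xbar) <= (1 + d) * (lam * s%:R / rho).
Proof.
move=> lam0 rho0 /andP[d0 d1] xst omd.
have := residue_energy lam0 omd; have := on_norm1_sqr_le xst rho0.
set t := on_norm1 _; set E := norm2 _ ^+ 2 => tE Et.
have t0 : 0 <= t by exact: on_norm1_ge0.
have o0 : 0 <= (1 - d) * lam * off_norm1 (x - xbar).
  by rewrite mulr_ge0 ?off_norm1_ge0 // mulr_ge0 ?subr_ge0 // ltW.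
have {}Et : s%:R * E <= s%:R * ((1 + d) * lam * t).
  by rewrite ler_wpM2l //; lra.
rewrite mulrA ler_pdivlMr // mulrC.
have [->|t_neq0] := eqVneq t 0.
  by rewrite mulr0 !mulr_ge0 ?addr_ge0 // ltW.
have tpos : 0 < t by rewrite lt0r t_neq0.
by rewrite -(ler_pM2r tpos); lra.
Qed.

(** In [residue_energy], the left-hand side is at least [rho |h|_2^2] and the
    right-hand side at most [2 lam sqrt(s) |h|_2]. *)
Lemma residue_error lam d x : 0 < lam -> 0 < rho -> 0 <= d <= 1 ->
  (#|off_supp x| <= st)%N -> omega A b lam x <= d * lam ->
  norm2 (x - xbar) <= 2 * lam * Num.sqrt s%:R / rho.
Proof.
move=> lam0 rho0 /andP[d0 d1] xst omd.
have xs : (norm0 (x - xbar)%R <= s + st)%N.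
  by rewrite (leq_trans (norm0_sub_xbar x)) // leq_add2l.
have := residue_energy lam0 omd; have := rho_minus_lb A xs.
have N0 := norm2_ge0 (x - xbar).
have : on_norm1 (x - xbar) <= Num.sqrt s%:R * norm2 (x - xbar).
  rewrite -(ler_pXn2r (n := 2)) ?nnegrE ?on_norm1_ge0 ?mulr_ge0 ?sqrtr_ge0 //.
  by rewrite exprMn sqr_sqrtr ?ler0n // sqr_sum_abs_le.
set t := on_norm1 _; set E := norm2 (A *m _) ^+ 2.
move: N0; set N := norm2 _ => N0; set q := Num.sqrt _ => tq NE Et.
have q0 : 0 <= q by exact: sqrtr_ge0.
have o0 : 0 <= (1 - d) * lam * off_norm1 (x - xbar).
  by rewrite mulr_ge0 ?off_norm1_ge0 // mulr_ge0 ?subr_ge0 // ltW.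
have t0 : 0 <= t by exact: on_norm1_ge0.
have key : rho * N ^+ 2 <= 2 * lam * (q * N).
  have : (1 + d) * lam * t <= 2 * lam * (q * N).
    by rewrite ler_pM ?mulr_ge0 ?addr_ge0 ?ler_wpM2r ?(ltW lam0) //; lra.
  by lra.
rewrite ler_pdivlMr // mulrC.
have [->|N_neq0] := eqVneq N 0.
  by rewrite mulr0 !mulr_ge0 // ltW.
have Npos : 0 < N by rewrite lt0r N_neq0.
by rewrite -(ler_pM2r Npos); lra.
Qed.

(** The invariant of the inner loop.  It bounds the objective and not the
    residue, because proximal steps decrease the former but need not decrease
    the latter. *)
Definition admissible lam x : Prop :=
  (#|off_supp x| <= st)%N /\
  phi A b lam x <= phi A b lam xbar + 2 * (1 + gamma) * (lam * s%:R / rho) * lam.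

(** By [residue_energy], [|h_(~S)|_1 <= gamma |h_S|_1], hence
    [|h|_1 <= (1 + gamma) |h_S|_1 <= 2 (1 + gamma) lam s / rho], and
    [residue_gap] turns this into a bound on the objective. *)
Lemma residue_admissible lam d x : 0 < lam -> 0 < rho -> 0 <= d < 1 ->
  (1 + d) / (1 - d) <= gamma ->
  (#|off_supp x| <= st)%N -> omega A b lam x <= d * lam -> admissible lam x.
Proof.
move=> lam0 rho0 /andP[d0 d1] dg xst omd; split=> //.
rewrite (le_trans (residue_gap lam0 omd)) // lerD2l.
have d01 : 0 <= d <= 1 by rewrite d0 ltW.
have := residue_on_norm1 lam0 rho0 d01 xst omd.
have := residue_energy lam0 omd; rewrite norm1_on_off.
have t0 := on_norm1_ge0 (x - xbar); have o0 := off_norm1_ge0 (x - xbar).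
set t := on_norm1 _ in t0 *; set o := off_norm1 _ in o0 *.
set B := lam * _ / _ => Eto tB.
have B0 : 0 <= B by rewrite divr_ge0 ?mulr_ge0 // ltW.
have og : o <= gamma * t.
  rewrite (le_trans _ (ler_wpM2r t0 dg)) // mulrAC ler_pdivlMr ?subr_gt0 //.
  rewrite -(ler_pM2r lam0).
  by have := sqr_ge0 (norm2 (A *m (x - xbar))); lra.
have g0 : 0 <= gamma by rewrite (le_trans _ dg) // divr_ge0 //; lra.
have tB2 : t <= 2 * B by nra.
rewrite [leRHS]mulrAC -!mulrA [leLHS]mulrC [leRHS]mulrC.
have : (1 + gamma) * t <= (1 + gamma) * (2 * B) by rewrite ler_wpM2l // addr_ge0.
have dl : 0 <= d * lam <= lam by rewrite mulr_ge0 ?(ltW lam0) // ler_piMl // ltW.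
by nra.
Qed.

Hypotheses (gamma_ge1 : 1 <= gamma) (rho_gt0 : 0 < rho).
Hypothesis st_large :
  16 * (Lmax + 2 * rho_plus A st) / rho * (1 + gamma) * s%:R < st%:R.

(** The objective bound reads
    [|A h|^2 / 2 + lam |x_(~S)|_1 <= lam (t + 2 (1 + gamma) B)], with
    [t = |h_S|_1] and [B = lam s / rho].  Together with [rho t^2 <= s |A h|^2]
    it is a quadratic inequality in [t], whose solution is at most
    [2 (1 + gamma) B] as soon as [gamma >= 1]. *)
Lemma admissible_bounds lam x : 0 < lam -> admissible lam x ->
  norm2 (A *m (x - xbar)) ^+ 2 <= 8 * (1 + gamma) * (lam * s%:R / rho) * lam /\
  off_norm1 x <= 4 * (1 + gamma) * (lam * s%:R / rho).
Proof.
move=> lam0 [xst]; rewrite /phi !lsq_sub subrr mulmx0 [norm2 0 ^+ 2]norm2_sqr dot0r.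
have := on_norm1_sqr_le xst rho_gt0.
have := norm1_xbar_sub x; rewrite off_norm1_sub.
have t0 := on_norm1_ge0 (x - xbar); have o0 := off_norm1_ge0 x.
set t := on_norm1 _ in t0 *; set o := off_norm1 _ in o0 *.
set E := norm2 _ ^+ 2; have E0 : 0 <= E by exact: sqr_ge0.
set B := lam * s%:R / rho => tri tE gap.
have B0 : 0 <= B by rewrite divr_ge0 ?mulr_ge0 // ltW.
have sB : lam * s%:R = B * rho by rewrite /B divfK ?lt0r_neq0.
have {}tri := ler_wpM2l (ltW lam0) tri.
have Eo : 2^-1 * E + lam * o <= lam * (t + 2 * (1 + gamma) * B) by lra.
have quad : t ^+ 2 <= 2 * B * (t + 2 * (1 + gamma) * B).
  rewrite -(ler_pM2l rho_gt0) (le_trans tE) //.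
  have : s%:R * E <= s%:R * (2 * lam * (t + 2 * (1 + gamma) * B)).
    by rewrite ler_wpM2l //; have := mulr_ge0 (ltW lam0) o0; lra.
  move=> /le_trans; apply.
  have -> : s%:R * (2 * lam * (t + 2 * (1 + gamma) * B))
    = 2 * (lam * s%:R) * (t + 2 * (1 + gamma) * B) by ring.
  by rewrite sB; lra.
have tB : t <= 2 * (1 + gamma) * B.
  rewrite leNgt; apply/negP => lt.
  have tpos : 0 < t.
    rewrite (le_lt_trans _ lt) // mulr_ge0 // mulr_ge0 // addr_ge0 //.
    exact: le_trans ler01 gamma_ge1.
  have h1 : 2 * (1 + gamma) * B * t < t * t by rewrite ltr_pM2r.
  have h2 : 0 <= (gamma - 1) * (B * t) by rewrite mulr_ge0 ?subr_ge0 // mulr_ge0.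
  have h3 : B * (2 * (1 + gamma) * B) <= B * t by rewrite ler_wpM2l // ltW.
  by move: quad; rewrite expr2; lra.
have tD : lam * (t + 2 * (1 + gamma) * B) <= lam * (4 * (1 + gamma) * B).
  by rewrite ler_wpM2l ?(ltW lam0) //; lra.
split; first by have := mulr_ge0 (ltW lam0) o0; lra.
by rewrite -(ler_pM2l lam0); lra.
Qed.

Lemma card_mul_le_sum (T : {set 'I_n}) (f : 'I_n -> R) a :
  (forall i, i \in T -> a <= f i) -> #|T|%:R * a <= \sum_(i in T) f i.
Proof.
move=> fa; rewrite -sum1_card natr_sum mulr_suml ler_sum // => i iT.
by rewrite mul1r fa.
Qed.

(** Testing the gradient [A^T A h] against the vector of its signs on [T]
    bounds [#|T| lam / 2] by [|A h|_2 |A u|_2], where [u] has [#|T|] entries of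
    modulus 1; this is where [rho_plus] at sparsity [st] enters. *)
Lemma large_gradient_count lam x (T : {set 'I_n}) : 0 < lam ->
  (#|T| <= st)%N -> (forall i, i \in T -> lam / 2 <= `|grad_lsq A b x i 0|) ->
  #|T|%:R * lam ^+ 2 <= 4 * (rho_plus A st * norm2 (A *m (x - xbar)) ^+ 2).
Proof.
move=> lam0 Tst Tg; have := card_mul_le_sum Tg.
move: (dot_grad_lsq x) Tg; set g := grad_lsq A b x => dotg Tg sumT.
pose u : 'cV[R]_n := \col_i (if i \in T then Num.sg (g i 0) else 0).
have uE i : u i 0 = if i \in T then Num.sg (g i 0) else 0 by rewrite mxE.
have gu : \sum_(i in T) `|g i 0| = dot g u.
  rewrite dotE big_mkcond; apply: eq_bigr => i _; rewrite uE.
  by case: ifP => _; rewrite ?mulr0 // mulrC -normrEsg.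
have uu : norm2 u ^+ 2 = #|T|%:R.
  rewrite norm2_sqr dotE -sum1_card natr_sum [RHS]big_mkcond.
  apply: eq_bigr => i _; rewrite uE; case: ifP => iT; rewrite ?mulr0 //.
  rewrite -expr2 sqr_sg; case: eqP => // gi0.
  by have := Tg i iT; rewrite gi0 normr0 leNgt divr_gt0.
have ust : (norm0 u <= st)%N.
  rewrite (leq_trans _ Tst) // subset_leq_card //; apply/fintype.subsetP => i.
  by rewrite !inE uE; case: ifP => //; rewrite eqxx.
have := cauchy_schwarz (A *m (x - xbar)) (A *m u); rewrite -dotg -gu.
have := rho_plus_ub A ust; rewrite uu.
move: sumT; set G := \sum_(i in T) _; set E := norm2 (A *m (x - xbar)) ^+ 2.
set k := #|T|%:R; set r := rho_plus A st => kG Au GE.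
have k0 : 0 <= k by exact: ler0n.
have E0 : 0 <= E by exact: sqr_ge0.
have : (k * (lam / 2)) ^+ 2 <= E * (r * k).
  rewrite (le_trans _ (le_trans GE (ler_wpM2l E0 Au))) //.
  have kl0 : 0 <= k * (lam / 2) by rewrite mulr_ge0 // divr_ge0 // ltW.
  by rewrite ler_pXn2r ?nnegrE // (le_trans kl0).
have [->|kn0] := eqVneq k 0.
  by move=> _; rewrite mul0r mulr_ge0 // mulr_ge0 // rho_plus_ge0.
have kpos : 0 < k by rewrite lt0r kn0.
have -> : (k * (lam / 2)) ^+ 2 = k * lam ^+ 2 * k / 4 by field.
by rewrite ler_pdivrMr // => count; rewrite -(ler_pM2r kpos); lra.
Qed.

(** A nonzero entry of [xp] outside [S] satisfies
    [lam <= `|L * x i 0 - g i 0|], so it lies in [T1] (large entries of [x])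
    or in [T2] (large entries of the gradient).  The l1 bound of
    [admissible_bounds] controls [#|T1|] and its energy bound controls
    [#|T2|]; the size assumed of [st] exceeds the sum of the two bounds. *)
Lemma prox_off_supp lam L x xp : 0 < lam -> 0 < L <= Lmax ->
  admissible lam x -> prox_step A b lam L x xp -> (#|off_supp xp| <= st)%N.
Proof.
move=> lam0 /andP[L0 LM] xadm /(prox_stepP A b lam0 L0)/subdifferential_norm1P xi_P.
have [Ebd obd] := admissible_bounds lam0 xadm.
move: st_large; set c := 1 + gamma in Ebd obd * => stl.
set g := grad_lsq A b x.
pose T1 := finset (fun i => (i \notin S) && (lam / 2 <= L * `|x i 0|)).
pose T2 := finset (fun i => lam / 2 <= `|g i 0|).
have sub : off_supp xp \subset T1 :|: T2.
  apply/fintype.subsetP => i; rewrite !inE => /andP[-> /= xpi]; rewrite -implyNb.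
  apply/implyP; rewrite -ltNge => Lx.
  have [xi1 xixp] := xi_P i.
  have lamxi : lam * prox_subgrad A b lam L x xp i 0
     = - (g i 0 + L * (xp i 0 - x i 0)).
    have := congr1 (fun v : 'cV_n => v i 0) (prox_subgradE A b L lam0 x xp).
    rewrite /model_grad -/g.
    by move: (prox_subgrad _ _ _ _ _ _) (g) => ? ?; rewrite !mxE.
  have e : prox_subgrad A b lam L x xp i 0 = Num.sg (xp i 0).
    by apply: (mulIf xpi); rewrite xixp normrEsg.
  have : lam <= `|L * x i 0 - g i 0|.
    have -> : L * x i 0 - g i 0 = Num.sg (xp i 0) * (lam + L * `|xp i 0|).
      rewrite mulrDr [Num.sg _ * lam]mulrC -e lamxi e mulrCA -numEsg; ring.
    rewrite normrM normr_sg xpi mul1r ger0_norm ?lerDl ?mulr_ge0 ?(ltW L0) //.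
    by rewrite addr_ge0 ?(ltW lam0) // mulr_ge0 // ltW.
  move=> /le_trans/(_ (ler_normB _ _)); rewrite normrM (gtr0_norm L0); lra.
have rp0 := rho_plus_ge0 A st.
have B0 : 0 <= c * s%:R / rho.
  rewrite divr_ge0 ?(ltW rho_gt0) // mulr_ge0 // /c addr_ge0 //.
  exact: le_trans ler01 gamma_ge1.
have large : 16 * Lmax * (c * s%:R / rho)
    + 32 * (rho_plus A st * (c * s%:R / rho)) < st%:R.
  by rewrite (le_lt_trans _ stl) // le_eqVlt; apply/orP; left; apply/eqP; ring.
have LM0 : 0 <= Lmax * (c * s%:R / rho) by rewrite mulr_ge0 // (le_trans (ltW L0)).
have T2_sub_card : forall T : {set 'I_n}, T \subset T2 -> (#|T| <= st)%N ->
    #|T|%:R <= 32 * (rho_plus A st * (c * s%:R / rho)).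
  move=> T /fintype.subsetP TT2 Tst.
  have Tg i : i \in T -> lam / 2 <= `|g i 0| by move=> /TT2; rewrite inE.
  have l2 : 0 < lam ^+ 2 by exact: exprn_gt0.
  rewrite -(ler_pM2r l2) (le_trans (large_gradient_count lam0 Tst Tg)) //.
  have := ler_wpM2l rp0 Ebd.
  by lra.
(* The count of large gradient entries needs a set of at most [st] elements;
   if [T2] had more, one of its subsets with exactly [st] elements would
   already contradict the bound. *)
have T2st : (#|T2| <= st)%N.
  rewrite leqNgt; apply/negP => /ltnW/card_geqP[l [ul sl lT2]].
  have cl : #|finset (mem l)| = st by rewrite cardsE (card_uniqP ul).
  have := T2_sub_card (finset (mem l)); rewrite cl leqnn => /(_ _ isT).
  have -> : finset (mem l) \subset T2.
    by apply/fintype.subsetP => i; rewrite inE => /lT2.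
  by move=> /(_ isT); lra.
have T1b : #|T1|%:R <= 8 * Lmax * (c * s%:R / rho).
  have h : #|T1|%:R * (lam / 2) <= L * off_norm1 x.
    have T1g i : i \in T1 -> lam / 2 <= L * `|x i 0| by rewrite inE => /andP[].
    rewrite (le_trans (card_mul_le_sum T1g)) // -mulr_sumr ler_wpM2l ?(ltW L0) //.
    rewrite /off_norm1 [leRHS](bigID (mem T1)) /=.
    rewrite (eq_bigl (fun i => (i \in ~: S) && (i \in T1))).
      by rewrite lerDl sumr_ge0.
    by move=> i; rewrite !inE; case: (x i 0 == 0); case: (xbar i 0 == 0).
  have : L * off_norm1 x <= Lmax * (4 * c * (lam * s%:R / rho)).
    by rewrite ler_pM ?(ltW L0) ?off_norm1_ge0.
  have l2 : 0 < lam / 2 by rewrite divr_gt0.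
  by move=> Lo; rewrite -(ler_pM2r l2); lra.
have := T2_sub_card T2 (subxx _) T2st.
have : #|off_supp xp|%:R <= #|T1|%:R + #|T2|%:R :> R.
  by rewrite -natrD ler_nat (leq_trans (subset_leq_card sub)) // leq_card_setU.
rewrite -(ler_nat R); lra.
Qed.

End SparsityOffSupport.

(** * Line search, proximal gradient and homotopy *)

Section Homotopy.
Set Implicit Arguments.
Unset Strict Implicit.
Variables (R : realType) (m n : nat) (A : 'M[R]_(m, n)) (xbar : 'cV[R]_n).
Variables (gamma ginc gdec Lmin : R) (st : nat).
Local Notation b := (A *m xbar).
Local Notation s := (norm0 xbar).
Local Notation rho := (rho_minus A (norm0 xbar + st)).
Local Notation smooth := (rho_plus A (norm0 xbar + 2 * st)).
Local Notation Lmax := (ginc * rho_plus A (norm0 xbar + 2 * st)).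
Local Notation admissible := (admissible A xbar gamma st).
Hypotheses (ginc_gt1 : 1 < ginc) (gdec_ge1 : 1 <= gdec).
Hypotheses (gamma_ge1 : 1 <= gamma) (rho_gt0 : 0 < rho).
Hypothesis st_large :
  16 * (Lmax + 2 * rho_plus A st) / rho * (1 + gamma) * s%:R < st%:R.
Hypotheses (Lmin_gt0 : 0 < Lmin) (Lmin_le : Lmin <= Lmax).
Implicit Types (x xp : 'cV[R]_n) (L M lam eps : R).

(** The model exceeds the objective as soon as [L] dominates the curvature of
    the least-squares term along [xp - x], which is [(s + 2 st)]-sparse. *)
Lemma model_majorizes lam L x xp : (#|off_supp xbar x| <= st)%N ->
  (#|off_supp xbar xp| <= st)%N -> smooth <= L ->
  phi A b lam xp <= psi A b lam L x xp.
Proof.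
move=> xst xpst sL; rewrite /phi /psi lerD2r (lsq_taylor _ _ x xp) lerD2l.
have ds : (norm0 (xp - x)%R <= s + 2 * st)%N.
  by rewrite (leq_trans (norm0_sub xbar xp x)) // leq_add2l mul2n -addnn leq_add.
have := rho_plus_ub A ds.
have := ler_wpM2r (sqr_ge0 (norm2 (xp - x))) sL.
lra.
Qed.

Lemma accepted_step lam L x xp : 0 < lam -> 0 < L <= Lmax -> admissible lam x ->
  prox_step A b lam L x xp -> phi A b lam xp <= psi A b lam L x xp ->
  admissible lam xp /\
  phi A b lam xp + L / 2 * norm2 (x - xp) ^+ 2 <= phi A b lam x.
Proof.
move=> lam0 LL xadm prox acc; have /andP[L0 _] := LL.
have xpst := prox_off_supp gamma_ge1 rho_gt0 st_large lam0 LL xadm prox.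
have /(prox_stepP A b lam0 L0)/(psi_strong_convex lam0)/(_ x) := prox.
rewrite psi_base => dec.
have dphi : phi A b lam xp + L / 2 * norm2 (x - xp) ^+ 2 <= phi A b lam x by lra.
split=> //; split=> //; case: xadm => _; apply: le_trans.
have : 0 <= L / 2 * norm2 (x - xp) ^+ 2.
  by rewrite mulr_ge0 ?sqr_ge0 // divr_ge0 // ltW.
lra.
Qed.

Lemma rejected_constant lam L x xp : 0 < lam -> 0 < L <= Lmax -> admissible lam x ->
  prox_step A b lam L x xp -> phi A b lam xp > psi A b lam L x xp -> L < smooth.
Proof.
move=> lam0 LL xadm prox; rewrite !ltNge; apply: contra => sL.
apply: model_majorizes sL; first by case: xadm.
by have := prox_off_supp gamma_ge1 rho_gt0 st_large lam0 LL xadm prox.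
Qed.

(** A rejected constant is below [rho_plus A (s + 2 st)], so one increase by
    the factor [ginc] stays within the range where sparsity is preserved. *)
Lemma rejected_next L : L < smooth -> L * ginc <= Lmax.
Proof. by move=> Ls; rewrite mulrC ler_pM2l ?(lt_trans ltr01) // ltW. Qed.

Lemma line_search_spec lam L x xp M : 0 < lam -> 0 < L <= Lmax ->
  admissible lam x -> line_search A b ginc lam x L xp M ->
  [/\ admissible lam xp, L <= M <= Lmax, prox_step A b lam M x xp &
      phi A b lam xp + M / 2 * norm2 (x - xp) ^+ 2 <= phi A b lam x].
Proof.
move=> lam0 + xadm ls.
elim: {L xp M} ls => [L xp prox acc|L xp xr M prox rej _ IH] LL.
  have [xpadm dec] := accepted_step lam0 LL xadm prox acc.
  by split=> //; rewrite lexx; case/andP: LL.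
have Ls := rejected_constant lam0 LL xadm prox rej; have /andP[L0 _] := LL.
have [|? /andP[LM ?] ? ?] := IH.
  by rewrite rejected_next // mulr_gt0 // (lt_trans ltr01).
split=> //; rewrite (le_trans _ LM) // ler_peMr // ltW //.
Qed.

(** Every rejection adds at least [Lmin * (ginc - 1)] to the constant, and a
    constant at or above [rho_plus A (s + 2 st)] is never rejected. *)
Lemma line_search_terminates lam L x : 0 < lam -> Lmin <= L <= Lmax ->
  admissible lam x -> exists xp M, line_search A b ginc lam x L xp M.
Proof.
move=> lam0 LL xadm; pose step := Lmin * (ginc - 1).
have step0 : 0 < step by rewrite mulr_gt0 // subr_gt0.
have [k smooth_le] : exists k : nat, smooth <= L + k%:R * step.
  exists (Num.trunc (smooth / step)).+1.
  have := truncnS_gt (smooth / step); rewrite ltr_pdivrMr // => /ltW/le_trans; apply.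
  by rewrite lerDr (le_trans (ltW Lmin_gt0)) //; case/andP: LL.
suff : forall k L, Lmin <= L <= Lmax -> smooth <= L + k%:R * step ->
    exists xp M, line_search A b ginc lam x L xp M by move=> /(_ k L LL smooth_le).
elim=> [|{}k IH] {LL smooth_le} {}L /andP[Ll Lu] smooth_le.
all: have L0 := lt_le_trans Lmin_gt0 Ll; have LL : 0 < L <= Lmax by rewrite L0.
all: have [xp prox] := prox_step_exists A b lam0 L0 x.
all: have [acc|rej] := leP (phi A b lam xp) (psi A b lam L x xp);
  first by exists xp, L; apply: line_search_stop.
all: have Ls := rejected_constant lam0 LL xadm prox rej.
  by move: smooth_le; rewrite mul0r addr0 leNgt Ls.
have grow : L + step <= L * ginc.
  have : step <= L * (ginc - 1) by rewrite ler_wpM2r // subr_ge0 ltW.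
  lra.
have [||xr [M ls]] := IH (L * ginc).
- by rewrite rejected_next // andbT (le_trans Ll) // (le_trans _ grow) // lerDl ltW.
- by move: smooth_le; rewrite -natr1; lra.
by exists xr, M; apply: line_search_next ls.
Qed.

(** A bound for the sup norm of [(A^T A - M) v] relative to [norm2 v], uniform
    in the accepted constants [M]. *)
Definition residue_const : R := \sum_i \sum_j `|(A^T *m A) i j| + Lmax.

Lemma residue_const_gt0 : 0 < residue_const.
Proof.
rewrite ltr_wpDl ?(lt_le_trans Lmin_gt0) // sumr_ge0 // => i _.
exact: sumr_ge0.
Qed.

(** At [xp], the subgradient [prox_subgrad] cancels the gradient of the model,
    so what is left of [grad + lam xi] is the difference between the
    gradients of the objective and of the model, which is
    [(A^T A - M) (xp - x)]. *)
Lemma prox_residue_le lam M x xp : 0 < lam -> 0 < M <= Lmax ->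
  prox_step A b lam M x xp -> omega A b lam xp <= residue_const * norm2 (x - xp).
Proof.
move=> lam0 /andP[M0 ML] /(prox_stepP A b lam0 M0) sub.
rewrite (le_trans (omega_le _ _ _ sub)) // prox_subgradE // /model_grad opprD addrA.
rewrite grad_lsqB -[xp - x]opprB mulmxN scalerN opprK.
rewrite (le_trans (ler_normD _ _)) // normrN mulrDl lerD ?sup_norm_mulmx_le //.
rewrite mx_normZ (gtr0_norm M0) ler_pM // ?(ltW M0) //.
apply: sup_norm_le => [|i]; [exact: norm2_ge0 | exact: abs_entry_le_norm2].
Qed.

Lemma next_constant M : Lmin <= M <= Lmax -> Lmin <= Num.max Lmin (M / gdec) <= Lmax.
Proof.
move=> /andP[LM ML]; rewrite le_max lexx ge_max Lmin_le /=.
rewrite ler_pdivrMr ?(lt_le_trans ltr01) // (le_trans ML) // ler_peMr //.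
exact: le_trans (ltW Lmin_gt0) Lmin_le.
Qed.

Lemma prox_grad_spec lam eps x L xh Mh : 0 < lam -> Lmin <= L <= Lmax ->
  admissible lam x -> prox_grad A b ginc gdec Lmin lam eps x L xh Mh ->
  [/\ admissible lam xh, Lmin <= Mh <= Lmax & omega A b lam xh <= eps].
Proof.
move=> lam0 + + pg.
elim: {x L xh Mh} pg => [x L xp M ls om|x L xp M xh Mh ls _ _ IH] /andP[Ll Lu] xadm.
all: have LL : 0 < L <= Lmax by rewrite Lu (lt_le_trans Lmin_gt0).
all: have [xpadm /andP[LM ML] _ _] := line_search_spec lam0 LL xadm ls.
all: have MM : Lmin <= M <= Lmax by rewrite ML (le_trans Ll).
  by [].
by apply: IH => //; exact: next_constant.
Qed.

Lemma phi_ge0 lam x : 0 < lam -> 0 <= phi A b lam x.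
Proof.
move=> lam0; rewrite /phi /lsq addr_ge0 // mulr_ge0 ?sqr_ge0 ?norm1_ge0 //.
exact: ltW.
Qed.

(** A decrease of the objective that every accepted step achieves when it leaves
    a residue above [eps]: by [prox_residue_le], such a step has length at
    least [eps / residue_const]. *)
Definition residue_drop eps : R := Lmin / 2 * (eps / residue_const) ^+ 2.

Lemma prox_grad_step lam eps x L : 0 < lam -> 0 < eps ->
  Lmin <= L <= Lmax -> admissible lam x ->
  exists xp M, [/\ line_search A b ginc lam x L xp M, admissible lam xp,
    Lmin <= M <= Lmax &
    eps < omega A b lam xp -> phi A b lam xp + residue_drop eps <= phi A b lam x].
Proof.
move=> lam0 eps0 LL xadm.
have [xp [M ls]] := line_search_terminates lam0 LL xadm.
have /andP[Ll Lu] := LL; have L0 := lt_le_trans Lmin_gt0 Ll.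
have L0u : 0 < L <= Lmax by rewrite L0.
have [xpadm /andP[LM ML] prox dec] := line_search_spec lam0 L0u xadm ls.
have MM : Lmin <= M <= Lmax by rewrite ML (le_trans Ll).
exists xp, M; split=> // om; rewrite (le_trans _ dec) // lerD2l.
have M0 : 0 < M <= Lmax by rewrite ML (lt_le_trans L0).
have C0 := residue_const_gt0.
have far : eps / residue_const <= norm2 (x - xp).
  rewrite ler_pdivrMr // mulrC (le_trans (ltW om)) //.
  exact: prox_residue_le lam0 M0 prox.
rewrite ler_pM ?sqr_ge0 ?(divr_ge0 (ltW _)) //.
  by rewrite ler_pM2r ?invr_gt0 // (le_trans Ll).
by rewrite ler_pXn2r ?nnegrE ?norm2_ge0 // divr_ge0 // ltW.
Qed.

Lemma prox_grad_terminates lam eps x L : 0 < lam -> 0 < eps ->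
  Lmin <= L <= Lmax -> admissible lam x ->
  exists xh Mh, prox_grad A b ginc gdec Lmin lam eps x L xh Mh.
Proof.
move=> lam0 eps0; have drop0 : 0 < residue_drop eps.
  by rewrite mulr_gt0 ?exprn_gt0 // divr_gt0 // residue_const_gt0.
have [k phi_le] : exists k : nat, phi A b lam x <= k%:R * residue_drop eps.
  exists (Num.trunc (phi A b lam x / residue_drop eps)).+1.
  by rewrite -ler_pdivrMr // ltW // truncnS_gt.
elim: k x L phi_le => [|k IH] x L phi_le LL xadm.
all: have [xp [M [ls xpadm MM decr]]] := prox_grad_step lam0 eps0 LL xadm.
all: have [om|om] := leP (omega A b lam xp) eps;
  first by exists xp, M; apply: prox_grad_stop.
  by have := phi_ge0 xp lam0; have := decr om; move: phi_le; rewrite mul0r; lra.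
have phi_xp : phi A b lam xp <= k%:R * residue_drop eps.
  by have := decr om; move: phi_le; rewrite -natr1; lra.
have [xh [Mh pg]] := IH xp _ phi_xp (next_constant MM) xpadm.
by exists xh, Mh; apply: prox_grad_next pg.
Qed.

Variables (delta delta' eta : R).
Hypotheses (delta_gt0 : 0 < delta) (delta'_lt1 : 0 <= delta' < 1).
Hypothesis gamma_delta' : (1 + delta') / (1 - delta') <= gamma.
Hypotheses (eta01 : 0 < eta <= 1) (delta_eta : (1 + delta) / (1 + delta') <= eta).
Hypothesis lambda0_gt0 : 0 < lambda0 A b.
Local Notation lambda := (lambda_seq A b eta).

Lemma lambda_seqE K : lambda K = eta ^+ K * lambda0 A b.
Proof. by elim: K => [|K IH] /=; rewrite ?mul1r // IH exprS mulrA. Qed.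

Lemma lambda_seq_gt0 K : 0 < lambda K.
Proof. by rewrite lambda_seqE mulr_gt0 // exprn_gt0 //; case/andP: eta01. Qed.

Lemma warm_start K x : omega A b (lambda K) x <= delta * lambda K ->
  omega A b (lambda K.+1) x <= delta' * lambda K.+1.
Proof.
move=> om; have lam0 := lambda_seq_gt0 K.
rewrite (le_trans (omega_scale_le A b x lam0 eta01)) //.
have d'0 : 0 < 1 + delta' by case/andP: delta'_lt1; lra.
have : 1 + delta <= eta * (1 + delta') by rewrite -ler_pdivrMr.
by move=> /(ler_wpM2r (ltW lam0)) /=; lra.
Qed.

(** At the initial level, [A^T b / lambda0] has sup norm 1 and is therefore a
    subgradient at 0 that cancels the gradient [- A^T b]. *)
Lemma residue_zero : omega A b (lambda0 A b) 0 <= 0.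
Proof.
pose xi := (lambda0 A b)^-1 *: (A^T *m b).
have xi_sub : subdifferential (@norm1 R n) 0 xi.
  apply/subdifferential_norm1P => i; rewrite [(0 : 'cV_n) i 0]mxE mulr0 normr0.
  split=> //; rewrite mxE normrM normfV (gtr0_norm lambda0_gt0) mulrC.
  by rewrite ler_pdivrMr // mul1r abs_entry_le.
rewrite (le_trans (omega_le A b _ xi_sub)) // /grad_lsq mulmx0 sub0r mulmxN.
by rewrite scalerA divff ?lt0r_neq0 // scale1r addNr normr0.
Qed.

Lemma homotopy_invariant K x M : homotopy_iter A b ginc gdec Lmin eta delta K x M ->
  [/\ (#|off_supp xbar x| <= st)%N, Lmin <= M <= Lmax &
      omega A b (lambda K) x <= delta * lambda K].
Proof.
elim=> {K x M} [|K x M x' M' _ [xst MM om] pg].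
  split; last by rewrite (le_trans residue_zero) // mulr_ge0 // ltW.
    rewrite /off_supp (_ : supp 0 = finset.set0) ?finset.set0D ?cards0 //.
    by apply/setP => i; rewrite !inE mxE eqxx.
  by rewrite lexx.
have adm := residue_admissible (lambda_seq_gt0 K.+1) rho_gt0 delta'_lt1 gamma_delta'
  xst (warm_start om).
by have [[]] := prox_grad_spec (lambda_seq_gt0 K.+1) MM adm pg.
Qed.

Lemma homotopy_exists K :
  exists x M, homotopy_iter A b ginc gdec Lmin eta delta K x M.
Proof.
elim: K => [|K [x [M run]]]; first by exists 0, Lmin; constructor.
have [xst MM om] := homotopy_invariant run.
have adm := residue_admissible (lambda_seq_gt0 K.+1) rho_gt0 delta'_lt1 gamma_delta'
  xst (warm_start om).
have eps0 : 0 < delta * lambda K.+1 by rewrite mulr_gt0 // lambda_seq_gt0.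
have [x' [M' pg]] := prox_grad_terminates (lambda_seq_gt0 K.+1) eps0 MM adm.
by exists x', M'; apply: homotopy_next pg.
Qed.

(** The error bound is applied at the next level [lambda K.+1], where the
    output of stage [K] is a warm start. *)
Lemma homotopy_error K x M : homotopy_iter A b ginc gdec Lmin eta delta K x M ->
  norm2 (x - xbar) <= eta ^+ K.+1 * (2 * lambda0 A b * Num.sqrt s%:R / rho).
Proof.
move=> /homotopy_invariant[xst _ /warm_start om].
have d1 : 0 <= delta' <= 1 by case/andP: delta'_lt1 => -> /ltW ->.
rewrite (le_trans (residue_error (lambda_seq_gt0 K.+1) rho_gt0 d1 xst om)) //.
by rewrite lambda_seqE le_eqVlt; apply/orP; left; apply/eqP; ring.
Qed.

End Homotopy.

Theorem corollary1 (R : realType) (m n : nat) (A : 'M[R]_(m, n))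
  (xbar : 'cV[R]_n) (b : 'cV[R]_m) (hb : b = A *m xbar)
  (ginc gdec gamma delta' Lmin : R) (st : nat)
  (hginc : 1 < ginc) (hgdec : 1 <= gdec)
  (hgamma : 0 < gamma) (hdelta' : 0 < delta' < 1)
  (hgamma_delta' : (1 + delta') / (1 - delta') < gamma)
  (hrho : 0 < rho_minus A (norm0 xbar + 2 * st))
  (hst : 16 * (ginc * rho_plus A (norm0 xbar + 2 * st) + 2 * rho_plus A st)
           / rho_minus A (norm0 xbar + st)
           * (1 + gamma) * (norm0 xbar)%:R < st%:R)
  (hLmin : 0 < Lmin <= ginc * rho_plus A (norm0 xbar + 2 * st))
  (delta eta : R)
  (hdelta : 0 < delta < 1) (heta : 0 < eta < 1)
  (hdelta_eta : (1 + delta) / (1 + delta') <= eta) :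
  forall lam_tgt : R, 0 < lam_tgt <= lambda0 A b ->
  forall K : nat, K%:Z <= num_outer A b eta lam_tgt ->
    (exists (xhat : 'cV[R]_n) (Mhat : R),
       homotopy_iter A b ginc gdec Lmin eta delta K xhat Mhat) /\
    (forall (xhat : 'cV[R]_n) (Mhat : R),
       homotopy_iter A b ginc gdec Lmin eta delta K xhat Mhat ->
       norm2 (xhat - xbar) <=
         eta ^+ K.+1 *
         (2 * lambda0 A b * Num.sqrt (norm0 xbar)%:R
          / rho_minus A (norm0 xbar + st))).
Proof.
move=> lam_tgt /andP[tgt0 tgt_le] K _; subst b.
have lambda0_gt0 := lt_le_trans tgt0 tgt_le.
have s_gt0 : (0 < norm0 xbar)%N.
  rewrite lt0n; apply: contraTneq lambda0_gt0 => /eqP.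
  rewrite cards_eq0 => /eqP supp0.
  suff -> : xbar = 0 by rewrite /lambda0 !mulmx0 normr0 ltxx.
  apply/matrixP => i j; rewrite (ord1 j) mxE; apply/eqP.
  by move/setP/(_ i): supp0; rewrite !inE => /negbFE.
have rho_gt0 : 0 < rho_minus A (norm0 xbar + st).
  apply: rho_minus_gt0W hrho; rewrite addn_gt0 s_gt0 /=.
  by rewrite leq_add2l leq_pmull.
have /andP[Lmin0 Lmin_le] := hLmin; have /andP[delta0 _] := hdelta.
have /andP[d'0 d'1] := hdelta'; have /andP[eta0 eta1] := heta.
have gamma1 : 1 <= gamma.
  rewrite (le_trans _ (ltW hgamma_delta')) // ler_pdivlMr ?subr_gt0 //; lra.
have d'01 : 0 <= delta' < 1 by rewrite ltW.
have eta01 : 0 < eta <= 1 by rewrite eta0 ltW.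
have gamma_le := ltW hgamma_delta'.
split.
  exact: (homotopy_exists hginc hgdec gamma1 rho_gt0 hst Lmin0 Lmin_le delta0
    d'01 gamma_le eta01 hdelta_eta lambda0_gt0).
move=> xhat Mhat; exact: (homotopy_error hginc hgdec gamma1 rho_gt0 hst Lmin0
  Lmin_le delta0 d'01 gamma_le eta01 hdelta_eta lambda0_gt0).
Qed.
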